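(* Let $I$ be a non-zero ideal of $S = k[x_1,x_2,\ldots]$. For each integer $n\ge 1$ let $\mathcal G_n$ be the reduced Gröbner base for the ideal $I\cap S^{\langle n\rangle}$ inside the polynomial ring $S^{\langle n\rangle}=k[x_1,\ldots,x_n]$, and put $$\overline{\mathcal G}=\bigcup_{m=1}^{\infty}\Bigl(\bigcap_{n=m}^{\infty}\mathcal G_n\Bigr)\subset S .$$ Then $\overline{\mathcal G}$ is a reduced Gröbner base for $I$.
   Context: $k$ is a field, $S=k[x_1,x_2,\ldots]$ is the polynomial ring in countably infinitely many variables, and $\mathrm{Mon}(S)$ is the set of its monomials. A monomial order is a total order $>$ on $\mathrm{Mon}(S)$ which is a well-order and satisfies $u>v\Rightarrow wu>wv$ for all monomials $u,v,w$. A monomial order on $\mathrm{Mon}(S)$ is fixed, and $S^{\langle n\rangle}=k[x_1,\ldots,x_n]$ carries the restricted order. For $0\ne f\in S$, $\mathrm{lt}(f)$, $\mathrm{lm}(f)$, $\mathrm{lc}(f)$ denote the leading term, leading monomial and leading coefficient. The initial ideal $\mathrm{in}(I)$ of an ideal $I$ is the ideal generated by all $\mathrm{lt}(f)$, $0\neq f\in I$ (with $\mathrm{in}(0)=0$). A subset $\mathcal G\subset I$ is a Gröbner base for $I$ if $\{\mathrm{lm}(g)\mid g\in\mathcal G\}$ generates $\mathrm{in}(I)$; it is reduced if every $g\in\mathcal G$ is monic ($\mathrm{lc}(g)=1$) and $\mathrm{lm}(g)$ does not divide any term of $h$ for any $h\in\mathcal G$, $h\neq g$. The same definitions are used in $S^{\langle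 n\rangle}$; any ideal of $S^{\langle n\rangle}$ has a unique reduced Gröbner base (the empty set for the zero ideal). *)

(* Defs.v *)
From mathcomp Require Import all_boot all_order all_algebra.
From mathcomp Require Import finmap.
From mathcomp Require Import boolp classical_sets.
From mathcomp Require wochoice.
From mathcomp.multinomials Require Import monalg.

Set Implicit Arguments.
Unset Strict Implicit.
Unset Printing Implicit Defensive.

Import GRing.Theory.
Local Open Scope classical_set_scope.
Local Open Scope ring_scope.

(* The variable x_(i+1) of the polynomial ring is indexed by i : nat. *)
Notation Mon := {cmonom nat}.
Notation Pol k := {malg k[Mon]}.

Definition mdvd (u v : Mon) : Prop := exists w : Mon, v = mmul w u.

Section MonomialOrder.
Variable le : rel Mon.

Definition mlt (u v : Mon) : bool := (u != v) && le u v.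

Definition monomial_order : Prop :=
  [/\ wochoice.total_order le,
      wochoice.well_order le
    & forall u v w : Mon, mlt u v -> mlt (mmul w u) (mmul w v)].

Variable k : fieldType.
Implicit Types (f g : Pol k) (A I G : set (Pol k)).

(* For a total order le, the default value 1 is only reached when f = 0. *)
Definition lm f : Mon :=
  xget mone [set m | wochoice.maximum_of le (mem (msupp f)) m].

Definition lc f : k := f@_(lm f).

Definition lterm f : Pol k := << lc f *g lm f >>.

(* In the definitions below, A is the ambient subring of Pol k: it is setT for
   Pol k itself, and polys_in k n for k[x_1, ..., x_n]. *)
Definition is_ideal A I : Prop :=
  [/\ I `<=` A, I 0, (forall f g, I f -> I g -> I (f + g))
    & forall a f, A a -> I f -> I (a * f)].

Definition ideal_gen A G : set (Pol k) := smallest (is_ideal A) G.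

Definition initial_ideal A I : set (Pol k) :=
  ideal_gen A [set lterm f | f in I `\ 0].

(* lm is meaningful for nonzero polynomials only. *)
Definition groebner_base A I G : Prop :=
  G `<=` I /\ ideal_gen A [set << lm g >> | g in G `\ 0] = initial_ideal A I.

(* lc 0 = 0, so the monicity condition excludes 0 from G. *)
Definition reduced_groebner_base A I G : Prop :=
  [/\ groebner_base A I G,
      (forall g, G g -> lc g = 1)
    & forall g h, G g -> G h -> h <> g ->
        forall m, m \in msupp h -> ~ mdvd (lm g) m].

End MonomialOrder.

Definition polys_in (k : fieldType) (n : nat) : set (Pol k) :=
  [set f | forall m : Mon, m \in msupp f ->
           forall i : nat, (n <= i)%N -> m i = 0%N].

Arguments polys_in k n : clear implicits.

(* Main.v *)
Require Import Defs.
From mathcomp Require Import all_boot all_order all_algebra.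
From mathcomp Require Import finmap.
From mathcomp Require Import boolp classical_sets.
From mathcomp.multinomials Require Import monalg.

Local Open Scope classical_set_scope.
Local Open Scope ring_scope.

(** The elements of S come in finitely many variables, so membership in I is
    visible in some I_n = I `&` polys_in n; what has to be controlled is that
    the bases G n stabilise at each minimal leading monomial of I, although
    an element of G n and the one of G n.+1 with the same leading monomial
    may differ.

    The stable element can be named in advance.  Let u be a leading monomial of
    I that no other leading monomial of I properly divides.  Reducing u modulo
    I (lemma [normal_form], a well-founded induction on monomials) gives
    h = u - r in I, where no monomial of r is a leading monomial of I
    (lemma [reduced_element]).  As soon as n is so large that h lies in
    polys_in n, h belongs to G n (lemma [reduced_element_in_basis]): some g
    in G n has lm g | u, hence lm g = u; if g - h were nonzero, its leading
    monomial would be a leading monomial of I_n below u, so it would come from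
    g and not from h, while being divisible by the leading monomial of an
    element of G n other than g, against reducedness.

    Hence h lies in the limit set, and every leading monomial of I is a
    multiple of such a u, which gives the Groebner property.  Reducedness only
    involves two elements at a time, and any two elements of the limit set lie
    in a common G n. *)

(** * Monomial orders and leading monomials *)

Section LeadingMonomials.

Variables (le : rel Mon) (Hle : monomial_order le).

Lemma mo_refl : reflexive le.
Proof. by case: Hle => -[[[]]]. Qed.

Lemma mo_trans : transitive le.
Proof. by case: Hle => -[[[]]]. Qed.

Lemma mo_anti (u v : Mon) : le u v -> le v u -> u = v.
Proof. by case: Hle => -[[_ anti] _] _ _ uv vu; apply: anti; rewrite uv. Qed.

Lemma mo_total (u v : Mon) : le u v || le v u.
Proof. by case: Hle => -[_ tot] _ _; apply: tot. Qed.

Lemma mlt_le (u v : Mon) : mlt le u v -> le u v.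
Proof. by case/andP. Qed.

Lemma mltNge (u v : Mon) : mlt le u v -> ~~ le v u.
Proof.
case/andP => /eqP uv leuv; apply/negP => levu.
exact/uv/mo_anti.
Qed.

Lemma mo_min (P : set Mon) (x : Mon) :
  P x -> exists2 z, P z & forall y, P y -> le z y.
Proof.
case: Hle => _ wo _ Px.
have [|z [[/asboolP Pz minz] _]] := wo [pred m | `[< P m >]].
  by exists x; apply/asboolP.
by exists z => // y Py; apply: minz; apply/asboolP.
Qed.

Lemma mo_ind (P : Mon -> Prop) :
  (forall u, (forall v, mlt le v u -> P v) -> P u) -> forall u, P u.
Proof.
move=> IH u; apply: contrapT => nPu.
have [z nPz minz] := @mo_min [set m | ~ P m] u nPu.
apply: nPz; apply: IH => v ltvz; apply: contrapT => /minz lezv.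
by case/negP: (mltNge _ _ ltvz).
Qed.

(** If something were below 1, the least such element z would exceed its own
    square. *)
Lemma mo_ge1 (u : Mon) : le mone u.
Proof.
have [//|leu1] := orP (mo_total mone u).
have [->|neu1] := eqVneq u mone; first exact: mo_refl.
have [|z ltz1 minz] := @mo_min [set m | mlt le m mone] u.
  by rewrite /mlt /= neu1.
have ltzz : mlt le (mmul z z) z.
  by case: Hle => _ _ /(_ z mone z ltz1); rewrite mulm1.
have/minz : mlt le (mmul z z) mone.
  have lezz1 := mo_trans _ _ _ (mlt_le _ _ ltzz) (mlt_le _ _ ltz1).
  rewrite /mlt lezz1 andbT; apply/eqP => zz1; case/negP: (mltNge _ _ ltz1).
  by rewrite -zz1 mlt_le.
by rewrite (negPf (mltNge _ _ ltzz)).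
Qed.

Lemma mdvd_le (u v : Mon) : mdvd u v -> le u v.
Proof.
case=> w ->; have [->|new1] := eqVneq w mone; first by rewrite mul1m mo_refl.
have lt1w : mlt le mone w by rewrite /mlt eq_sym new1 mo_ge1.
case: Hle => _ _ /(_ _ _ u lt1w)/mlt_le.
by rewrite mulm1 mulmC.
Qed.

Lemma max_exists (s : seq Mon) : s != [::] ->
  exists2 m, m \in s & forall x, x \in s -> le x m.
Proof.
elim: s => // a [_ _|b s /(_ isT)[m ms maxm] _].
  by exists a => [|x]; rewrite inE // => /eqP ->; apply: mo_refl.
have [leam|lema] := orP (mo_total a m).
  by exists m => [|x]; rewrite inE ?ms ?orbT // => /predU1P[-> //|/maxm].
exists a => [|x]; rewrite inE ?eqxx //.
by case/predU1P => [->|/maxm lexm]; [exact: mo_refl|exact: mo_trans lema].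
Qed.

Variable k : fieldType.
Implicit Types (f g h p q : Pol k).

Lemma lm_spec f : f <> 0 ->
  lm le f \in msupp f /\ forall m, m \in msupp f -> le m (lm le f).
Proof.
move=> f0; have [|m mf maxm] := max_exists (msupp f).
  apply/eqP => s0; apply/f0/eqP; rewrite -msupp_eq0; apply/eqP/fsetP => x.
  by rewrite [LHS](congr1 (fun s : seq Mon => x \in s) s0) in_fset0.
by apply: (@xgetPex _ mone [set m | wochoice.maximum_of le (mem (msupp f)) m]);
  exists m.
Qed.

Lemma lm_supp f : f <> 0 -> lm le f \in msupp f.
Proof. by case/lm_spec. Qed.

Lemma le_lm f m : m \in msupp f -> le m (lm le f).
Proof.
have [->|/eqP/lm_spec[_]] := eqVneq f 0; last exact.
by rewrite msupp0 in_fset0.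
Qed.

Lemma supp_neq0 f m : m \in msupp f -> f <> 0.
Proof. by move=> mf f0; rewrite f0 msupp0 in_fset0 in mf. Qed.

Lemma lmE f u :
  u \in msupp f -> (forall m, m \in msupp f -> le m u) -> lm le f = u.
Proof.
move=> uf maxu; apply: mo_anti; last exact: le_lm.
exact/maxu/lm_supp/supp_neq0/uf.
Qed.

Lemma lc_neq0 f : f <> 0 -> lc le f != 0.
Proof. by move=> f0; rewrite mcoeff_neq0 lm_supp. Qed.

Lemma lc1_neq0 f : lc le f = 1 -> f <> 0.
Proof.
move=> + f0; rewrite f0 /lc mcoeff0 => /eqP.
by rewrite eq_sym GRing.oner_eq0.
Qed.

Lemma supp_lterm f : f <> 0 -> msupp (lterm le f) = [fset lm le f]%fset.
Proof. by move=> f0; rewrite msuppU (negPf (lc_neq0 _ f0)). Qed.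

Lemma suppB_or f g m :
  m \in msupp (f - g) -> m \in msupp f \/ m \in msupp g.
Proof. by move/(fsubsetP (msuppB_le _ _)); rewrite in_fsetU => /orP. Qed.

Lemma suppD_or f g m :
  m \in msupp (f + g) -> m \in msupp f \/ m \in msupp g.
Proof. by move/(fsubsetP (msuppD_le _ _)); rewrite in_fsetU => /orP. Qed.

(** * Ideals *)

Lemma ideal_gen_ideal (A : set (Pol k)) (X : set (Pol k)) :
  is_ideal A A -> X `<=` A -> is_ideal A (ideal_gen A X).
Proof.
move=> idA XA; split.
- exact: smallest_sub.
- by move=> J [[_ J0 _ _] _].
- move=> f g Xf Xg J JX; have [[_ _ JD _] _] := JX.
  by apply: JD; [apply: Xf|apply: Xg].
- move=> a f Aa Xf J JX; have [[_ _ _ JM] _] := JX.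
  by apply: JM => //; apply: Xf.
Qed.

Lemma ideal_scale (I : set (Pol k)) c f : is_ideal setT I -> I f -> I (c *: f).
Proof. by move=> [_ _ _ IM] If; rewrite -mul_malgC; apply: IM. Qed.

Lemma ideal_sub (I : set (Pol k)) f g :
  is_ideal setT I -> I f -> I g -> I (f - g).
Proof.
move=> idI If Ig; have [_ _ ID _] := idI.
by apply: ID => //; rewrite -GRing.scaleN1r; apply: ideal_scale.
Qed.

Lemma lterm_dvd f g : g <> 0 -> mdvd (lm le g) (lm le f) ->
  exists a, lterm le f = a * << lm le g >>.
Proof.
move=> g0 [w lmf]; exists << lc le f *g w >>.
by rewrite malgM_def fgmulUU GRing.mulr1 -lmf.
Qed.

(** Each lterm f is a multiple of some << lm g >>, and each << lm g >> is a
    scalar multiple of lterm g, so both generating sets span the same ideal. *)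
Lemma groebner_of_divides (I G : set (Pol k)) : is_ideal setT I -> G `<=` I ->
  (forall f, I f -> f <> 0 ->
     exists2 g, G g /\ g <> 0 & mdvd (lm le g) (lm le f)) ->
  groebner_base le setT I G.
Proof.
move=> idI GI dvd; split; [exact: GI|apply/seteqP; split].
  apply: smallest_sub; first exact: ideal_gen_ideal.
  move=> _ [g [Gg g0] <-].
  have -> : << lm le g >> = (lc le g)^-1%:MP * lterm le g.
    by rewrite malgM_def fgmulUU mul1m GRing.mulVf // lc_neq0.
  have [_ _ _ inM] : is_ideal setT (initial_ideal le setT I).
    exact: ideal_gen_ideal.
  apply: inM => //; apply: sub_gen_smallest; exists g => //.
  by split=> //; exact: GI.
apply: smallest_sub; first exact: ideal_gen_ideal.
move=> _ [f [If f0] <-]; have [g [Gg g0] /lterm_dvd[//|a ->]] := dvd f If f0.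
have [_ _ _ genM] :
    is_ideal setT (ideal_gen setT [set (<< lm le g >> : Pol k) | g in G `\ 0]).
  exact: ideal_gen_ideal.
by apply: genM => //; apply: sub_gen_smallest; exists g.
Qed.

(** * Polynomials in finitely many variables *)

Lemma polys_in_ideal n : is_ideal (polys_in k n) (polys_in k n).
Proof.
split=> // [m|f g fn gn m /suppD_or[/fn|/gn]|a f an fn m] //.
  by rewrite msupp0 in_fset0.
case/msuppM_le => u [v [/an ua /fn vf ->]] i ni.
by rewrite cmM ua ?vf.
Qed.

Lemma polys_inB n f g :
  polys_in k n f -> polys_in k n g -> polys_in k n (f - g).
Proof. by move=> fn gn m /suppB_or[/fn|/gn]. Qed.

Lemma polys_in_large f :
  exists N, forall n, (N <= n)%N -> polys_in k n f.
Proof.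
exists (\max_(m <- msupp f) \max_(i <- finsupp m) i.+1)%N => n Nn m mf i ni.
apply/eqP; rewrite cmE_eq0; apply/negP => im.
have : (i < n)%N; last by rewrite ltnNge ni.
have iM : (i < \max_(j <- finsupp m) j.+1)%N.
  exact: (leq_bigmax_seq (F := S) i im isT).
apply: leq_trans iM (leq_trans _ Nn).
exact: (leq_bigmax_seq (F := fun v : Mon => \max_(j <- finsupp v) j.+1)%N m mf
  isT).
Qed.

(** The polynomials of polys_in n all of whose monomials are multiples of
    leading monomials of G form an ideal, hence contain the leading terms. *)
Lemma groebner_divides (n : nat) (I G : set (Pol k)) f :
  groebner_base le (polys_in k n) (I `&` polys_in k n) G ->
  I f -> polys_in k n f -> f <> 0 ->
  exists2 g, G g & mdvd (lm le g) (lm le f).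
Proof.
move=> [GI GE] If fn f0.
pose J := [set h : Pol k | polys_in k n h /\
  forall m, m \in msupp h -> exists2 g, G g & mdvd (lm le g) m].
have idJ : is_ideal (polys_in k n) J.
  have [_ pn0 pnD pnM] := polys_in_ideal n.
  split=> [h [] //||h1 h2 [n1 J1] [n2 J2]|a h an [hn Jh]].
  - by split=> [|m]; [exact: pn0|rewrite msupp0 in_fset0].
  - by split=> [|m /suppD_or[/J1|/J2]]; first exact: pnD.
  split=> [|m /msuppM_le[u [v [ua /Jh[g Gg [w vE]] ->]]]].
    exact: (pnM a h an hn).
  by exists g; [exact: Gg|exists (mmul u w); rewrite vE mulmA].
have : J (lterm le f).
  have : initial_ideal le (polys_in k n) (I `&` polys_in k n) (lterm le f).
    apply: sub_gen_smallest; exists f; last by [].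
    by split; [split|exact: f0].
  rewrite -GE; apply: smallest_sub; first exact: idJ.
  move=> _ [g [Gg g0] <-].
  have gn : polys_in k n g by have [] := GI g Gg.
  split=> m; rewrite msuppU1 in_fset1 => /eqP ->.
    exact/gn/lm_supp.
  by exists g; [exact: Gg|exists mone; rewrite mul1m].
by case=> _; apply; rewrite (supp_lterm _ f0) in_fset1 eqxx.
Qed.

(** * Normal forms *)

Definition is_lm (I : set (Pol k)) (m : Mon) : Prop :=
  exists2 q, I q /\ q <> 0 & lm le q = m.

(** Cancelling the leading term of p, either against an element of I or by
    moving it into the remainder, leaves a polynomial below lm p. *)
Lemma normal_form (I : set (Pol k)) (u : Mon) p : is_ideal setT I ->
  (forall m, m \in msupp p -> mlt le m u) ->
  exists2 r, I (p - r) &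
    forall m, m \in msupp r -> mlt le m u /\ ~ is_lm I m.
Proof.
move=> idI; elim/mo_ind: u p => u IH p ltpu; have [_ I0 _ _] := idI.
have [->|/eqP p0] := eqVneq p 0.
  by exists 0 => [|m]; rewrite ?GRing.subr0 // msupp0 in_fset0.
have ltu := ltpu _ (lm_supp _ p0).
have lt_tail s : s@_(lm le p) = p@_(lm le p) ->
    (forall m, m \in msupp s -> le m (lm le p)) ->
    forall m, m \in msupp (p - s) -> mlt le m (lm le p).
  move=> sp les m mps; apply/andP; split.
    apply/eqP => mE; move: mps.
    by rewrite mE -mcoeff_neq0 mcoeffB sp GRing.subrr eqxx.
  by case/suppB_or: mps => [/le_lm|/les].
have lt_trans m : mlt le m (lm le p) -> mlt le m u.
  move=> ltm; have lemu := mo_trans _ _ _ (mlt_le _ _ ltm) (mlt_le _ _ ltu).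
  rewrite /mlt lemu andbT.
  by apply/eqP => mu; move: (mltNge _ _ ltm); rewrite mu (mlt_le _ _ ltu).
have [[q [Iq q0] qE]|nlm] := EM (is_lm I (lm le p)).
  pose s := (lc le p / lc le q) *: q.
  have Is : I s by exact: ideal_scale.
  have [|r Ir rstd] := IH _ ltu (p - s).
    apply: lt_tail => [|m /(fsubsetP (msuppZ_le _ _))]; last first.
      by rewrite -qE; exact: le_lm.
    by rewrite mcoeffZ -{1}qE GRing.divfK // lc_neq0.
  exists r => [|m /rstd[/lt_trans]//].
  have -> : p - r = (p - s - r) - (- s).
    by rewrite GRing.opprK GRing.addrAC GRing.subrK.
  by apply: ideal_sub => //; rewrite -GRing.scaleN1r; apply: ideal_scale.
have [|r Ir rstd] := IH _ ltu (p - lterm le p).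
  apply: lt_tail => [|m]; first by rewrite mcoeffUU.
  by rewrite (supp_lterm _ p0) in_fset1 => /eqP ->; apply: mo_refl.
exists (lterm le p + r); first by rewrite GRing.opprD GRing.addrA.
move=> m /suppD_or[|/rstd[/lt_trans]//].
by rewrite (supp_lterm _ p0) in_fset1 => /eqP ->.
Qed.

(** Made monic, an element of I with leading monomial u only needs its tail
    replaced by the normal form of that tail. *)
Lemma reduced_element (I : set (Pol k)) (u : Mon) : is_ideal setT I ->
  is_lm I u ->
  exists h, [/\ I h, h@_u = 1 &
    forall m, m \in msupp h -> m = u \/ mlt le m u /\ ~ is_lm I m].
Proof.
move=> idI [q [Iq q0] qE]; pose q1 := (lc le q)^-1 *: q.
have q1u : q1@_u = 1 by rewrite mcoeffZ -{1}qE GRing.mulVf // lc_neq0.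
have [|r Ir rstd] := @normal_form I u (q1 - << u >>) idI.
  move=> m mq; apply/andP; split.
    apply/eqP => mu; move: mq.
    by rewrite mu -mcoeff_neq0 mcoeffB q1u mcoeffUU GRing.subrr eqxx.
  case/suppB_or: mq => [/(fsubsetP (msuppZ_le _ _))/le_lm|].
    by rewrite qE.
  by rewrite msuppU1 in_fset1 => /eqP ->; apply: mo_refl.
exists (<< u >> + r); split.
- have -> : << u >> + r = q1 - (q1 - << u >> - r).
    rewrite !GRing.opprB [RHS]GRing.addrC GRing.addrA GRing.subrK.
    exact: GRing.addrC.
  by apply: ideal_sub => //; apply: ideal_scale.
- have ur : u \notin msupp r.
    by apply/negP => /rstd[]; rewrite /mlt eqxx.
  by rewrite mcoeffD mcoeffUU (mcoeff_outdom ur) GRing.addr0.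
move=> m /suppD_or[|/rstd]; last by right.
by rewrite msuppU1 in_fset1 => /eqP; left.
Qed.

(** * Stabilisation of the bases *)

(** The element g of Gn with leading monomial u and the candidate h differ by an
    element of I_n = I `&` polys_in k n in which u cancels.  A monomial of the
    tail of h is not a leading monomial of I, and one of the tail of g is not a
    leading monomial of I_n because Gn is reduced; so the difference is 0. *)
Lemma reduced_element_in_basis (I : set (Pol k)) (u : Mon) h n Gn :
  is_ideal setT I ->
  reduced_groebner_base le (polys_in k n) (I `&` polys_in k n) Gn ->
  (forall v, is_lm I v -> mdvd v u -> v = u) ->
  I h -> h@_u = 1 ->
  (forall m, m \in msupp h -> m = u \/ mlt le m u /\ ~ is_lm I m) ->
  polys_in k n h -> Gn h.
Proof.
move=> idI [Gb G1 Gred] minu Ih hu hstd hn.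
have uh : u \in msupp h by rewrite -mcoeff_neq0 hu GRing.oner_neq0.
have h0 := supp_neq0 _ _ uh.
have lmh : lm le h = u.
  by apply: lmE => // m /hstd[->|[/mlt_le]//]; apply: mo_refl.
have [g Gg] := groebner_divides n I Gn h Gb Ih hn h0; rewrite lmh => gu.
have [Ig gn] : (I `&` polys_in k n) g by case: Gb => GI _; exact: GI.
have g0 := lc1_neq0 _ (G1 _ Gg).
have lmg : lm le g = u by apply: minu => //; exists g.
suff /eqP : g - h = 0 by rewrite GRing.subr_eq0 => /eqP <-.
apply: contrapT => d0; set d := g - h in d0.
have Id : I d by exact: ideal_sub.
have dn : polys_in k n d by exact: polys_inB.
have dsupp := lm_supp _ d0.
have neu : lm le d <> u.
  move=> dE; move: dsupp; rewrite dE -mcoeff_neq0 mcoeffB hu.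
  by move: (G1 _ Gg); rewrite /lc lmg => ->; rewrite GRing.subrr eqxx.
have dg : lm le d \in msupp g.
  case/suppB_or: dsupp => // /hstd[//|[_ []]].
  by exists d.
have [g' Gg' g'd] := groebner_divides n I Gn d Gb Id dn d0.
have [g'E|/eqP neg] := eqVneq g g'; last exact: Gred Gg' Gg neg _ dg g'd.
apply/neu/mo_anti; first by rewrite -lmg le_lm.
by apply: mdvd_le; rewrite -lmg g'E.
Qed.

(** Divisors are smaller for the order, so the least leading monomial of I among
    the divisors of m is minimal for divisibility. *)
Lemma minimal_lm (I : set (Pol k)) (m : Mon) : is_lm I m ->
  exists u, [/\ is_lm I u, mdvd u m & forall v, is_lm I v -> mdvd v u -> v = u].
Proof.
move=> Im; have [|u [Iu um] minu] := @mo_min [set v | is_lm I v /\ mdvd v m] m.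
  by split=> //; exists mone; rewrite mul1m.
exists u; split=> // v Iv vu; apply: mo_anti; first exact: mdvd_le.
apply: minu; split=> //; case: vu um => w -> [w' ->].
by exists (mmul w' w); rewrite mulmA.
Qed.

End LeadingMonomials.

Theorem theorem1p12 (k : fieldType) (le : rel Mon) (Hle : monomial_order le)
    (I : set (Pol k)) (HI : is_ideal setT I) (HI0 : I <> [set 0])
    (G : nat -> set (Pol k))
    (HG : forall n : nat, (1 <= n)%N ->
       reduced_groebner_base le (polys_in k n) (I `&` polys_in k n) (G n)) :
  reduced_groebner_base le setT I
    (\bigcup_(m in [set m | (1 <= m)%N])
       \bigcap_(n in [set n | (m <= n)%N]) G n).
Proof.
have stable g : (\bigcup_(m in [set m | (1 <= m)%N])
       \bigcap_(n in [set n | (m <= n)%N]) G n) g ->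
    exists2 m, (1 <= m)%N & forall n, (m <= n)%N -> G n g.
  by case=> m m1 Gg; exists m.
split.
- apply: groebner_of_divides => // [g /stable[m m1 Gg]|f If f0].
    by have [[GI _] _ _] := HG m m1; have [] := GI g (Gg m (leqnn m)).
  have [|u [Iu uf minu]] := minimal_lm le Hle k I (lm le f); first by exists f.
  have [h [Ih hu hstd]] := reduced_element le Hle k I u HI Iu.
  have uh : u \in msupp h by rewrite -mcoeff_neq0 hu GRing.oner_neq0.
  exists h; last first.
    suff -> : lm le h = u by [].
    by apply: lmE => // m /hstd[->|[/mlt_le]//]; apply: mo_refl.
  split; last exact: supp_neq0 uh.
  have [N hN] := polys_in_large k h.
  exists (maxn 1 N); first exact: leq_maxl.
  move=> n /=; rewrite geq_max => /andP[n1 Nn].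
  exact: (reduced_element_in_basis le Hle k I u h n _ HI (HG n n1) minu Ih hu
    hstd (hN n Nn)).
- move=> g /stable[m m1 Gg]; have [_ G1 _] := HG m m1.
  exact/G1/Gg.
- move=> g h /stable[m m1 Gg] /stable[m' m'1 Gh].
  have [|_ _ Gred] := HG (maxn m m'); first by rewrite leq_max m1.
  by apply: Gred; [exact/Gg/leq_maxl|exact/Gh/leq_maxr].
Qed.
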